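(* Let $X \in \mathbb{R}^{n\times p}$, $\lambda > 0$ and let $\mathrm{pen}:\mathbb{R}^p \to \mathbb{R}$ be a polyhedral gauge. Let $\beta \in \mathbb{R}^p$. 1. (Geometric characterization) The pattern of $\beta$ is accessible with respect to $X$ and $\lambda\,\mathrm{pen}$ if and only if $\mathrm{row}(X) \cap \partial_{\mathrm{pen}}(\beta) \neq \varnothing$. 2. (Analytic characterization) The pattern of $\beta$ is accessible with respect to $X$ and $\lambda\,\mathrm{pen}$ if and only if for every $b \in \mathbb{R}^p$ the implication $X\beta = Xb \implies \mathrm{pen}(\beta) \le \mathrm{pen}(b)$ holds.
   Context: A prime denotes transpose. A (real-valued) polyhedral gauge on $\mathbb{R}^p$ is a function of the form $\mathrm{pen}(b) = \max\{u_1'b,\dots,u_k'b\}$ for some $u_1,\dots,u_k \in \mathbb{R}^p$ with $u_1 = 0$; $\partial_{\mathrm{pen}}(\beta)$ is its subdifferential at $\beta$. For $y\in\mathbb{R}^n$ let $S_{X,\lambda\mathrm{pen}}(y) = \mathrm{Arg}\min_{b\in\mathbb{R}^p} \frac12\|y-Xb\|_2^2 + \lambda\,\mathrm{pen}(b)$ be the set of minimizers. Write $b \overset{\mathrm{pen}}{\sim} \beta$ (''same pattern'') if $\partial_{\mathrm{pen}}(b) = \partial_{\mathrm{pen}}(\beta)$. The pattern of $\beta$ is accessible with respect to $X$ and $\lambda\,\mathrm{pen}$ if there exist $y\in\mathbb{R}^n$ and $\hat\beta \in S_{X,\lambda\mathrm{pen}}(y)$ with $\hat\beta \overset{\mathrm{pen}}{\sim}\beta$.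 $\mathrm{row}(X)$ is the column space of $X'$. *)

(* Defs.v *)
From mathcomp Require Import all_boot all_order all_algebra.
From mathcomp Require Import classical_sets reals.

Set Implicit Arguments.
Unset Strict Implicit.
Unset Printing Implicit Defensive.

Import Order.TTheory GRing.Theory Num.Theory.
Local Open Scope classical_set_scope.
Local Open Scope ring_scope.

Definition dotv {R : realType} {p : nat} (u v : 'cV[R]_p) : R :=
  \sum_(i < p) u i 0 * v i 0.

(* Not `|v|, which is the sup norm on matrices in MathComp-Analysis. *)
Definition norm2 {R : realType} {n : nat} (v : 'cV[R]_n) : R :=
  Num.sqrt (\sum_(i < n) v i 0 ^+ 2).

(* The family u_1, ..., u_k is indexed by 'I_k'.+1, so u_1 is u ord0 and k >= 1.
   The initial value of the big max is the first term of the family, so it adds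
   nothing to the maximum. *)
Definition polyhedral_gauge {R : realType} {p : nat} (pen : 'cV[R]_p -> R) :
    Prop :=
  exists (k' : nat) (u : 'I_k'.+1 -> 'cV[R]_p),
    u ord0 = 0 /\
    forall b, pen b =
      \big[Num.max/dotv (u ord0) b]_(i < k'.+1) dotv (u i) b.

Definition subdiff {R : realType} {p : nat} (f : 'cV[R]_p -> R)
    (b : 'cV[R]_p) : set 'cV[R]_p :=
  [set s | forall z, f b + dotv s (z - b) <= f z].

Definition argmin {R : realType} {T : Type} (f : T -> R) : set T :=
  [set x | forall z, f x <= f z].

Definition penalized_ls {R : realType} {n p : nat} (X : 'M[R]_(n, p))
    (lambda : R) (pen : 'cV[R]_p -> R) (y : 'cV[R]_n) : set 'cV[R]_p :=
  argmin (fun b => 2^-1 * norm2 (y - X *m b) ^+ 2 + lambda * pen b).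

Definition same_pattern {R : realType} {p : nat} (pen : 'cV[R]_p -> R)
    (b beta : 'cV[R]_p) : Prop :=
  subdiff pen b = subdiff pen beta.

Definition accessible {R : realType} {n p : nat} (X : 'M[R]_(n, p))
    (lambda : R) (pen : 'cV[R]_p -> R) (beta : 'cV[R]_p) : Prop :=
  exists (y : 'cV[R]_n) (betahat : 'cV[R]_p),
    penalized_ls X lambda pen y betahat /\ same_pattern pen betahat beta.

(* Row space as a set of column vectors: v^T lies in the span of the rows of X,
   i.e. v lies in the column space of X^T. *)
Definition row_space {R : realType} {n p : nat} (X : 'M[R]_(n, p)) :
    set 'cV[R]_p :=
  [set v | (v^T <= X)%MS].

(* Main.v *)
Require Import Defs.
From mathcomp Require Import all_boot all_order all_algebra.
From mathcomp Require Import classical_sets reals.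
From mathcomp Require Import ring lra.

Import Order.TTheory GRing.Theory Num.Theory.
Local Open Scope classical_set_scope.
Local Open Scope ring_scope.

(** Accessibility means that some vector with the pattern of [beta] minimizes a
    penalized least-squares objective, and such a minimizer [bh] has a cheap
    consequence: vectors with the same image under [X] have the same residual,
    so [pen] is minimal at [bh] among them.  Everything else follows from
    relating three properties at a single point [b0]:
    - [pen] is minimal at [b0] over the affine space [b0 + ker X];
    - some subgradient of [pen] at [b0] lies in the row space of [X];
    - [b0] minimizes the penalized objective for some response [y].
    The second implies the third with [y = X b0 + lambda w], where [X^T w] is
    the subgradient: completing the square shows that [b0] is a minimizer
    ([row_subgradient_penalized_ls]).  The third implies the first as said
    ([penalized_ls_fiber_min]).  That the first implies the second is the
    substantial part: it is a Hahn-Banach statement, holding for any convex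
    function ([fiber_min_row_subgradientP], from [convex_separation]).

    The second property only depends on [b0] through its subdifferential, so it
    passes from [bh] to [beta].  Polyhedral gauges enter through their convexity
    ([polyhedral_gauge_convex]). *)

(** * The inner product *)

Section Dotv.
Context {R : realType}.

Lemma dotvE p (u v : 'cV[R]_p) : dotv u v = (u^T *m v) 0 0.
Proof. by rewrite mxE; apply: eq_bigr => i _; rewrite mxE. Qed.

Lemma dotvDl p (u v w : 'cV[R]_p) : dotv (u + v) w = dotv u w + dotv v w.
Proof. by rewrite !dotvE linearD mulmxDl mxE. Qed.

Lemma dotvDr p (u v w : 'cV[R]_p) : dotv u (v + w) = dotv u v + dotv u w.
Proof. by rewrite !dotvE mulmxDr mxE. Qed.

Lemma dotvZl p (a : R) (u v : 'cV[R]_p) : dotv (a *: u) v = a * dotv u v.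
Proof. by rewrite !dotvE linearZ -scalemxAl mxE. Qed.

Lemma dotvZr p (a : R) (u v : 'cV[R]_p) : dotv u (a *: v) = a * dotv u v.
Proof. by rewrite !dotvE -scalemxAr mxE. Qed.

Lemma dotvC p (u v : 'cV[R]_p) : dotv u v = dotv v u.
Proof. by apply: eq_bigr => i _; rewrite mulrC. Qed.

Lemma dotv0 p (u : 'cV[R]_p) : dotv u 0 = 0.
Proof. by rewrite dotvE mulmx0 mxE. Qed.

Lemma dotv_ge0 p (u : 'cV[R]_p) : 0 <= dotv u u.
Proof. by apply: sumr_ge0 => i _; rewrite -expr2 sqr_ge0. Qed.

Lemma dotv_trmulmx n p (X : 'M[R]_(n, p)) (w : 'cV[R]_n) (v : 'cV[R]_p) :
  dotv (X^T *m w) v = dotv w (X *m v).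
Proof. by rewrite !dotvE trmx_mul trmxK mulmxA. Qed.

Lemma norm2_sqr p (v : 'cV[R]_p) : norm2 v ^+ 2 = dotv v v.
Proof.
rewrite sqr_sqrtr; last by apply: sumr_ge0 => i _; apply: sqr_ge0.
by apply: eq_bigr => i _; rewrite expr2.
Qed.

Lemma row_spaceP n p (X : 'M[R]_(n, p)) (s : 'cV[R]_p) :
  row_space X s <-> exists w, s = X^T *m w.
Proof.
split=> [/submxP[D sE]|[w ->]].
  by exists D^T; rewrite -trmx_mul -sE trmxK.
by apply/submxP; exists w^T; rewrite trmx_mul trmxK.
Qed.

End Dotv.

(** * Separation of a convex function from the kernel of a matrix *)

Definition convexf {R : realType} {p} (f : 'cV[R]_p -> R) : Prop :=
  forall x y (t : R), 0 <= t <= 1 ->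
    f (t *: x + (1 - t) *: y) <= t * f x + (1 - t) * f y.

(** The same inequality with weights that need not sum to one, as it comes up
    when [x] and [y] are combined so as to cancel a linear form. *)
Lemma convexf_weights (R : realType) p (f : 'cV[R]_p -> R) x y (a b : R) :
  convexf f -> 0 < a -> 0 < b ->
  (a + b) * f ((a + b)^-1 *: (a *: x + b *: y)) <= a * f x + b * f y.
Proof.
move=> cf a0 b0; have ab0 : 0 < a + b by exact: addr_gt0.
have t01 : 0 <= a / (a + b) <= 1.
  by rewrite divr_ge0 ?(ltW a0) ?(ltW ab0) //= ler_pdivrMr // mul1r lerDl ltW.
have := cf x y _ t01.
have -> : 1 - a / (a + b) = b / (a + b) by field; lra.
rewrite scalerDr !scalerA ![(a + b)^-1 * _]mulrC.
rewrite -(ler_pM2l ab0) => /le_trans; apply.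
by rewrite le_eqVlt; apply/orP; left; apply/eqP; field; lra.
Qed.

(** One dimension of the Hahn-Banach extension: on [ker M], the slopes
    [q h / dotv r h] over [dotv r h < 0] all lie below those over
    [dotv r h > 0], because a weighted mean of two such points is orthogonal to
    [r], where [q] is nonnegative.  Any [c] in between, here the supremum of the
    lower slopes, works. *)
Lemma convex_extension_step (R : realType) m p (M : 'M[R]_(m, p))
    (r : 'cV[R]_p) (q : 'cV[R]_p -> R) :
  convexf q ->
  (forall h, M *m h = 0 -> dotv r h = 0 -> 0 <= q h) ->
  exists c : R, forall h, M *m h = 0 -> c * dotv r h <= q h.
Proof.
move=> cq q0.
pose E : set R :=
  [set q h / dotv r h | h in [set h | M *m h = 0 /\ dotv r h < 0]].
have cross h1 h2 : M *m h1 = 0 -> M *m h2 = 0 -> 0 < dotv r h1 ->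
    dotv r h2 < 0 -> q h2 / dotv r h2 <= q h1 / dotv r h1.
  move=> M1 M2 r1 r2.
  have b0 : 0 < - dotv r h2 by rewrite oppr_gt0.
  have := convexf_weights _ _ _ h1 h2 _ _ cq b0 r1.
  set k := _ *: _ => kle.
  have k0 : 0 <= q k.
    apply: q0.
      by rewrite -scalemxAr mulmxDr -!scalemxAr M1 M2 !scaler0 addr0 scaler0.
    by rewrite dotvZr dotvDr !dotvZr mulNr [dotv r h1 * _]mulrC addNr mulr0.
  rewrite ler_pdivlMr // mulrAC ler_ndivrMr //.
  have : 0 <= - dotv r h2 * q h1 + dotv r h1 * q h2.
    by apply: le_trans kle; rewrite mulr_ge0 // addr_ge0 // ltW.
  by lra.
exists (sup E) => h Mh.
have [rh|rh|rh] := ltgtP (dotv r h) 0.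
- rewrite -ler_ndivrMr //; apply: ub_le_sup; last by exists h.
  (* The opposite of [h] provides an upper slope, which bounds [E]. *)
  exists (q (- h) / dotv r (- h)) => _ [h2 [M2 r2] <-].
  apply: cross => //; first by rewrite mulmxN Mh oppr0.
  by rewrite -scaleN1r dotvZr mulN1r oppr_gt0.
- rewrite -ler_pdivlMr //; apply: ge_sup.
    exists (q (- h) / dotv r (- h)); exists (- h) => //=.
    by rewrite mulmxN Mh oppr0 -scaleN1r dotvZr mulN1r oppr_lt0.
  by move=> _ [h2 [M2 r2] <-]; apply: cross.
- by rewrite rh mulr0; apply: q0.
Qed.

(** A finite-dimensional Hahn-Banach theorem: a convex function nonnegative on
    [ker M] dominates a linear form vanishing on [ker M].  Writing that form as
    [w] composed with [M] makes the induction run on the rows of [M]: dropping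
    a row enlarges the kernel by at most one dimension, and subtracting the
    multiple of that row found by the extension step restores nonnegativity. *)
Lemma convex_separation (R : realType) m p (M : 'M[R]_(m, p))
    (q : 'cV[R]_p -> R) :
  convexf q -> (forall h, M *m h = 0 -> 0 <= q h) ->
  exists w : 'cV[R]_m, forall h, dotv w (M *m h) <= q h.
Proof.
elim: m => [|m IH] in M q * => cq q0.
  exists 0 => h; rewrite [dotv _ _]big_ord0; apply: q0.
  by apply/matrixP => -[].
pose r := (row ord0 M)^T; pose M' := row' ord0 M.
have rE h : dotv r h = (M *m h) ord0 0.
  by rewrite mxE; apply: eq_bigr => i _; rewrite !mxE.
have M'E h i : (M' *m h) i 0 = (M *m h) (lift ord0 i) 0.
  by rewrite !mxE; apply: eq_bigr => j _; rewrite !mxE.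
have [|c cP] := convex_extension_step _ _ _ M' r q cq.
  move=> h M'h rh; apply: q0; apply/matrixP => i j; rewrite (ord1 j) [RHS]mxE.
  by case: (unliftP ord0 i) => [k|] ->; [rewrite -M'E M'h mxE | rewrite -rE].
have [||w wP] := IH M' (fun h => q h - c * dotv r h).
- move=> x y t t01; have := cq x y t t01; rewrite dotvDr !dotvZr.
  by move=> /(lerB) /(_ (lexx _)) /le_trans; apply; lra.
- by move=> h /cP; rewrite subr_ge0.
exists (\col_i if unlift ord0 i is Some k then w k 0 else c) => h.
rewrite /dotv big_ord_recl -rE mxE unlift_none.
have := wP h; rewrite lerBrDl; apply: le_trans; rewrite lerD2l.
by apply: ler_sum => i _; rewrite mxE liftK M'E.
Qed.

(** Apply the separation to the increment of [f] at [b0]; the separating form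
    [w] composed with [X] is given by the vector [X^T w]. *)
Lemma fiber_min_row_subgradientP (R : realType) n p (X : 'M[R]_(n, p))
    (f : 'cV[R]_p -> R) (b0 : 'cV[R]_p) : convexf f ->
  (row_space X `&` subdiff f b0 !=set0 <->
   forall b, X *m b0 = X *m b -> f b0 <= f b).
Proof.
move=> cf; split=> [[s [/row_spaceP[w ->] sub]] b Xb|fmin].
  by apply: le_trans (sub b); rewrite dotv_trmulmx mulmxBr Xb subrr dotv0 addr0.
have [||w wP] := convex_separation _ _ _ X (fun h => f (b0 + h) - f b0).
- move=> x y t t01; have := cf (b0 + x) (b0 + y) t t01.
  have -> : t *: (b0 + x) + (1 - t) *: (b0 + y) = b0 + (t *: x + (1 - t) *: y).
    by rewrite !scalerDr addrACA -scalerDl subrKC scale1r.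
  by lra.
- by move=> h Xh; rewrite subr_ge0; apply: fmin; rewrite mulmxDr Xh addr0.
exists (X^T *m w); split; first by apply/row_spaceP; exists w.
by move=> z; rewrite dotv_trmulmx -lerBrDl; have := wP (z - b0); rewrite subrKC.
Qed.

Lemma polyhedral_gauge_convex (R : realType) p (pen : 'cV[R]_p -> R) :
  polyhedral_gauge pen -> convexf pen.
Proof.
move=> [k [u [_ penE]]] x y t /andP[t0 t1].
have upen i b : dotv (u i) b <= pen b by rewrite penE; apply: le_bigmax_cond.
have bound i : dotv (u i) (t *: x + (1 - t) *: y) <= t * pen x + (1 - t) * pen y.
  by rewrite dotvDr !dotvZr lerD // ler_wpM2l // subr_ge0.
by rewrite [leLHS]penE; apply/bigmax_leP; split.
Qed.

(** * Minimizers of penalized least squares *)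

Lemma penalized_ls_fiber_min (R : realType) n p (X : 'M[R]_(n, p))
    (lambda : R) (pen : 'cV[R]_p -> R) y bh : 0 < lambda ->
  penalized_ls X lambda pen y bh ->
  forall b, X *m bh = X *m b -> pen bh <= pen b.
Proof. by move=> l0 hmin b Xb; have := hmin b; rewrite Xb lerD2l ler_pM2l. Qed.

(** With [d = X (z - b0)], the objective at [z] exceeds the one at [b0] by
    [dotv d d / 2 - lambda * dotv w d + lambda * (pen z - pen b0)], and the
    subgradient inequality bounds the last term below by [lambda * dotv w d]. *)
Lemma row_subgradient_penalized_ls (R : realType) n p (X : 'M[R]_(n, p))
    (lambda : R) (pen : 'cV[R]_p -> R) (w : 'cV[R]_n) b0 : 0 <= lambda ->
  subdiff pen b0 (X^T *m w) ->
  penalized_ls X lambda pen (X *m b0 + lambda *: w) b0.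
Proof.
move=> l0 sub z; rewrite !norm2_sqr addrAC subrr add0r.
have /(ler_wpM2l l0) := sub z; rewrite dotv_trmulmx.
set d := X *m (z - b0).
have -> : X *m b0 + lambda *: w - X *m z = lambda *: w + (-1) *: d.
  by rewrite scaleN1r /d mulmxBr opprB addrCA addrA.
rewrite !(dotvDl, dotvDr, dotvZl, dotvZr) (dotvC _ d w).
by have := dotv_ge0 _ d; lra.
Qed.

Lemma accessible_row_subgradientP (R : realType) n p (X : 'M[R]_(n, p))
    (lambda : R) (pen : 'cV[R]_p -> R) (beta : 'cV[R]_p) :
  0 < lambda -> convexf pen ->
  (accessible X lambda pen beta <->
   row_space X `&` subdiff pen beta !=set0).
Proof.
move=> l0 cpen; split=> [[y [bh [bhmin <-]]]|[s [/row_spaceP[w ->] sub]]].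
  apply/(fiber_min_row_subgradientP _ _ _ _ _ _ cpen).
  exact: penalized_ls_fiber_min bhmin.
exists (X *m beta + lambda *: w), beta; split=> //.
exact: row_subgradient_penalized_ls (ltW l0) sub.
Qed.

Theorem proposition4p2 (R : realType) (n p : nat) (X : 'M[R]_(n, p))
    (lambda : R) (lambda_gt0 : 0 < lambda)
    (pen : 'cV[R]_p -> R) (pen_gauge : polyhedral_gauge pen)
    (beta : 'cV[R]_p) :
  (accessible X lambda pen beta <->
     row_space X `&` subdiff pen beta !=set0) /\
  (accessible X lambda pen beta <->
     forall b : 'cV[R]_p, X *m beta = X *m b -> pen beta <= pen b).
Proof.
have cpen := polyhedral_gauge_convex _ _ _ pen_gauge.
have acc := accessible_row_subgradientP _ _ _ X _ _ beta lambda_gt0 cpen.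
split=> //; apply: (iff_trans acc).
exact: fiber_min_row_subgradientP.
Qed.
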